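(* Suppose that $\frac{f}{\varphi}\in L^1(\nu)$ for all $f\in Z$. Then $(\delta,Z_{\mathbb{H}})$ is a closable operator $L^2(\varphi\nu;\mathbb{H})\supset Z_{\mathbb{H}}\to L^2(\varphi\nu)$.
   Context: Let $d\in\mathbb{N}$, $\Omega:=\{\gamma\in C([0,1];\mathbb{R}^d):\gamma(0)=0\}$, and let $\nu$ be the Wiener measure on $\Omega$. Let $\mathbb{H}$ be the Cameron--Martin space of absolutely continuous $f:[0,1]\to\mathbb{R}^d$ with $f(0)=0$ and $f'\in L^2([0,1];\mathbb{R}^d)$, with inner product $\langle f,g\rangle_{\mathbb{H}}=\int_0^1\langle f'(x),g'(x)\rangle_{\mathbb{R}^d}\,dx$. The weight $\varphi:\Omega\to[0,\infty]$ is measurable with $\varphi\in L^1(\nu)$ (standing assumption), and $\varphi\nu$ denotes the measure with density $\varphi$ with respect to $\nu$. Let $Z$ be the set of cylindrical functions $F(\gamma)=f(\gamma(s_1),\dots,\gamma(s_k))$, $k\in\mathbb{N}$, $0<s_1<\dots<s_k=1$, $f\in C_p^\infty((\mathbb{R}^d)^k)$ (smooth, with $f$ and all partial derivatives of polynomial growth). For such $F$, $D_sF(\gamma)=\sum_{i=1}^k (s_i\wedge s)(\nabla_{s_i}f)(\gamma(s_1),\dots,\gamma(s_k))$, $s\in[0,1]$, with $\nabla_{s_i}f$ the gradient in the $i$th variable. $Z_{\mathbb{H}}$ is the set of all $\mathbb{H}$-valued cylindrical functions $\sum_{j=1}^kF_jh_j$ with $F_j\in Z$, $h_j\in\mathbb{H}$,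 $k\in\mathbb{N}$. $\delta$ is the usual divergence (Skorokhod integral) with respect to $\nu$, i.e. the adjoint of $D$ under $\nu$: $\int F\,\delta(z)\,d\nu=\int\langle DF,z\rangle_{\mathbb{H}}\,d\nu$.
   Formalization: Since Z_H need not lie in L²(φν;H), nor δ map it into L²(φν), under these hypotheses (e.g. d=1, φ=exp(γ(1)²/2)/(1+γ(1)²)), closability is stated for δ on those z in Z_H with z in L²(φν;H) and δ(z) in L²(φν). *)

(* Defs.v *)
From HB Require Import structures.
From mathcomp Require Import all_boot all_order all_algebra.
From mathcomp Require Import all_classical all_reals all_analysis.
From mathcomp Require Import measurable_realfun.

Set Implicit Arguments.
Unset Strict Implicit.
Unset Printing Implicit Defensive.
Import Order.TTheory GRing.Theory Num.Theory.
Import numFieldNormedType.Exports.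

Local Open Scope classical_set_scope.
Local Open Scope ring_scope.

Section density.
Local Open Scope ereal_scope.
Context d (T : measurableType d) (R : realType).
Variables (mu : {measure set T -> \bar R}) (phi : T -> \bar R).

Definition density_measure of measurable_fun [set: T] phi
    & (forall x, 0 <= phi x) : set T -> \bar R :=
  fun A => \int[mu]_(x in A) phi x.

Hypotheses (mphi : measurable_fun [set: T] phi) (phi0 : forall x, 0 <= phi x).

Local Notation nu := (density_measure mphi phi0).

Let density0 : nu set0 = 0.
Proof. exact: integral_set0. Qed.

Let density_ge0 A : 0 <= nu A.
Proof. by apply: integral_ge0 => x _; exact: phi0. Qed.

Let density_sigma_additive : semi_sigma_additive nu.
Proof.
move=> F mF tF mUF; rewrite /density_measure ge0_integral_bigcup//.
- by apply: is_cvg_ereal_nneg_natsum_cond => n _ _; exact: density_ge0.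
- exact: measurable_funTS.
Qed.

HB.instance Definition _ := isMeasure.Build _ _ _ nu
  density0 density_ge0 density_sigma_additive.

End density.
Arguments density_measure {d T R} mu {phi} _ _ _.

(** Continuous paths [0,1] -> R^d starting at 0, with the sigma-algebra
    generated by the coordinate maps; it is also the Borel sigma-algebra of the
    uniform norm. *)
Section paths.
Variables (R : realType) (d : nat).

Definition I01 : Type := set_type `[0 : R, 1]%classic.
HB.instance Definition _ := Topological.on I01.

Lemma I01_0_subproof : (0 : R) \in `[0 : R, 1]%classic.
Proof. by rewrite inE/= in_itv/= lexx ler01. Qed.

Definition I01_0 : I01 := exist _ 0 I01_0_subproof.

Record pathspace := Pathspace {
  path_fun :> continuousType I01 'rV[R]_d ;
  path_at0 : path_fun I01_0 = 0 }.

HB.instance Definition _ := gen_eqMixin pathspace.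
HB.instance Definition _ := gen_choiceMixin pathspace.

Definition path0 : pathspace :=
  @Pathspace (mkcts (@cst_continuous I01 'rV[R]_d 0)) erefl.
HB.instance Definition _ := isPointed.Build pathspace path0.

Definition path_cylinders : set (set pathspace) :=
  [set A | exists (t : I01) (j : 'I_d) (B : set R),
     measurable B /\ A = [set g : pathspace | B (g t 0 j)]].

HB.instance Definition _ := @isMeasurable.Build (sigma_display path_cylinders)
  pathspace <<s path_cylinders >> (@sigma_algebra0 _ setT path_cylinders)
  (@sigma_algebraC pathspace path_cylinders)
  (@sigma_algebra_bigcup _ setT path_cylinders).

End paths.
Arguments I01_0 {R}.

Section wiener.
Variables (R : realType) (d : nat).

(** All the coordinates of the increments of the path along t_0 < ... < t_n are
    independent, each of law N(0, t_{i+1} - t_i). [normal_prob] takes a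
    standard deviation. *)
Definition is_wiener (nu : probability (pathspace R d) R) : Prop :=
  forall (n : nat) (t : 'I_n.+1 -> I01 R),
    (forall i j : 'I_n.+1, (i < j)%N -> val (t i) < val (t j)) ->
  forall B : 'I_n -> 'I_d -> set R, (forall i j, measurable (B i j)) ->
  let t0 i := t (widen_ord (leqnSn n) i) in
  let t1 i := t (lift ord0 i) in
  nu [set g : pathspace R d | forall i j, B i j ((g (t1 i) - g (t0 i)) 0 j)] =
  (\prod_(i < n) \prod_(j < d)
     normal_prob 0 (Num.sqrt (val (t1 i) - val (t0 i))) (B i j))%E.

End wiener.

(** Elements of the Cameron-Martin space are functions on R, of which only the
    restriction to [0,1] matters. *)
Section cameron_martin.
Variables (R : realType) (d : nat).
Local Notation mu := (@lebesgue_measure R).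
Implicit Types h : R -> 'rV[R]_d.

Definition dotv (u v : 'rV[R]_d) : R := \sum_j u 0 j * v 0 j.

Definition abs_continuous01 h : Prop :=
  forall e : R, 0 < e -> exists2 del : R, 0 < del &
  forall (n : nat) (a b : 'I_n -> R),
    (forall i, 0 <= a i /\ a i <= b i /\ b i <= 1) ->
    (forall i j, i != j -> b i <= a j \/ b j <= a i) ->
    \sum_i (b i - a i) < del -> \sum_i `|h (b i) - h (a i)| < e.

(** The a.e. differentiability follows from absolute continuity; it is spelled
    out because [derive1] takes a junk value where h is not differentiable. *)
Definition cameron_martin : set (R -> 'rV[R]_d) :=
  [set h | [/\ abs_continuous01 h, h 0 = 0,
    {ae mu, forall x, x \in `[0, 1] -> derivable h x 1},
    (forall j, measurable_fun `[0 : R, 1] (fun x : R => derive1 h x 0 j : R)) &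
    (\int[mu]_(x in `[0%R, 1%R]) (dotv (derive1 h x) (derive1 h x))%:E < +oo)%E]].

Definition cm_inner (f g : R -> 'rV[R]_d) : R :=
  (\int[mu]_(x in `[0%R, 1%R]) dotv (derive1 f x) (derive1 g x))%R.

Definition cm_norm h : R := Num.sqrt (cm_inner h h).

End cameron_martin.

Section cylindrical.
Variables (R : realType) (d : nat).

(** A point of (R^d)^k is a k x d matrix, whose row i is the i-th variable. *)
Section smooth.
Variable k : nat.
Implicit Types f : 'M[R]_(k, d) -> R.

Definition partial f (ij : 'I_k * 'I_d) : 'M[R]_(k, d) -> R :=
  fun x => 'D_(delta_mx ij.1 ij.2) f x.

Definition partials f (l : seq ('I_k * 'I_d)) : 'M[R]_(k, d) -> R :=
  foldl partial f l.

Definition poly_growth f : Prop :=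
  exists (C : R) (N : nat), forall x, `|f x| <= C * (1 + `|x|) ^+ N.

Definition smooth_poly_growth f : Prop :=
  forall l : seq ('I_k * 'I_d),
    [/\ forall x i j, derivable (partials f l) x (delta_mx i j),
        continuous (partials f l) & poly_growth (partials f l)].

Definition gradient f (i : 'I_k) (x : 'M[R]_(k, d)) : 'rV[R]_d :=
  \row_j partial f (i, j) x.

End smooth.

(** A cylindrical function with [cyl_k.+1] instants 0 < s_1 < ... < s_k = 1. *)
Record cylinder := Cylinder {
  cyl_k : nat ;
  cyl_time : 'I_cyl_k.+1 -> I01 R ;
  cyl_base : 'M[R]_(cyl_k.+1, d) -> R ;
  cyl_time_gt0 : 0 < val (cyl_time ord0) ;
  cyl_time_lt : forall i j : 'I_cyl_k.+1,
    (i < j)%N -> val (cyl_time i) < val (cyl_time j) ;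
  cyl_time1 : val (cyl_time ord_max) = 1 ;
  cyl_smooth : smooth_poly_growth cyl_base }.

Definition cyl_eval (F : cylinder) (g : pathspace R d) : 'M[R]_((cyl_k F).+1, d) :=
  \matrix_i g (cyl_time i).

Definition cyl_fun (F : cylinder) (g : pathspace R d) : R :=
  cyl_base (cyl_eval F g).

Definition cyl_D (F : cylinder) (g : pathspace R d) (s : R) : 'rV[R]_d :=
  \sum_(i < (cyl_k F).+1)
    Num.min (val (cyl_time i)) s *: gradient (@cyl_base F) i (cyl_eval F g).

Definition Zcyl : set (pathspace R d -> R) := range cyl_fun.

Definition Zcyl_H : set (pathspace R d -> R -> 'rV[R]_d) :=
  [set z | exists (m : nat) (F : 'I_m -> pathspace R d -> R)
      (h : 'I_m -> R -> 'rV[R]_d),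
    [/\ forall j, Zcyl (F j), forall j, cameron_martin (h j) &
        z = fun g s => \sum_(j < m) F j g *: h j s]].

(** Integration by parts: Y is (a version of) the adjoint of D, seen as an
    operator L^2(nu) -> L^2(nu; H), at z. *)
Definition is_divergence (nu : probability (pathspace R d) R)
    (z : pathspace R d -> R -> 'rV[R]_d) (Y : pathspace R d -> R) : Prop :=
  Y \in Lfun nu 2%:E /\
  forall F : cylinder,
    (\int[nu]_g (cyl_fun F g * Y g)%:E =
     \int[nu]_g (cm_inner (cyl_D F g) (z g))%:E)%E.

(** For z in [Zcyl_H] such a Y exists and is nu-a.e. unique, so that [get] picks
    a version of it. *)
Definition divergence (nu : probability (pathspace R d) R)
    (z : pathspace R d -> R -> 'rV[R]_d) : pathspace R d -> R :=
  get (is_divergence nu z).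

End cylindrical.

Section closability.
Context disp (T : measurableType disp) (R : realType) (d : nat).
Variable mu : {measure set T -> \bar R}.

Definition L2H_norm (z : T -> R -> 'rV[R]_d) : \bar R :=
  Lnorm mu 2%:E (fun w => (cm_norm (z w))%:E).

(** Closability of a linear operator [A] from L^2(mu; H) to L^2(mu): if z_n -> 0
    and A z_n -> Y then Y = 0. The domain consists of those z in [dom] such that
    z is in L^2(mu; H) and A z is in L^2(mu); nothing forces all of [dom] to
    satisfy this. *)
Definition closable (dom : set (T -> R -> 'rV[R]_d))
    (A : (T -> R -> 'rV[R]_d) -> T -> R) : Prop :=
  forall (z : nat -> T -> R -> 'rV[R]_d) (Y : T -> R),
    (forall n, dom (z n)) ->
    (forall n, (L2H_norm (z n) < +oo)%E) ->
    (forall n, A (z n) \in Lfun mu 2%:E) ->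
    Y \in Lfun mu 2%:E ->
    L2H_norm (z n) @[n --> \oo] --> 0%E ->
    Lnorm mu 2%:E (fun w => (A (z n) w - Y w)%:E) @[n --> \oo] --> 0%E ->
    {ae mu, forall w, Y w = 0}.

End closability.

(* Main.v *)
Require Import Defs.
From HB Require Import structures.
From mathcomp Require Import all_boot all_order all_algebra.
From mathcomp Require Import all_classical all_reals all_analysis.
From mathcomp Require Import measurable_realfun.
From mathcomp Require Import ring lra.

Set Implicit Arguments.
Unset Strict Implicit.
Unset Printing Implicit Defensive.
Import Order.TTheory GRing.Theory Num.Theory.
Import numFieldNormedType.Exports.

Local Open Scope classical_set_scope.
Local Open Scope ring_scope.

(** Let z_n tend to 0 in L^2(phi nu; H) with delta z_n tending to Y in
    L^2(phi nu). For F in Z, integration by parts gives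
    E[F Y] = E<DF, z_n> - E[F (delta z_n - Y)].
    Splitting 1 as phi^(-1/2) phi^(1/2) in the Cauchy-Schwarz inequality bounds
    the two terms by E[|DF|^2 / phi]^(1/2) |z_n| and
    E[F^2 / phi]^(1/2) |delta z_n - Y|, with the norms taken under phi nu
    ([weighted_cauchy_schwarz]). Both F^2 and |DF|^2 belong to Z, the latter
    because |DF|^2 is a quadratic form with constant coefficients in the partial
    derivatives of the base function of F ([Zcyl_sqr_norm_D]); so the
    expectations are finite by assumption, and E[F Y] = 0
    ([divergence_limit_orthogonal]). The same inequality with F = 1 shows that Y
    is in L^1(nu).

    It remains to see that an integrable Y orthogonal to Z is 0
    ([Zcyl_orthogonal_eq0]). Products of logistic functions of the coordinates of
    the path belong to Z: the logistic function solves s' = s (1 - s), so all its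
    derivatives are polynomials in s and are bounded. When their slopes tend to
    infinity these products tend to the indicators of the sets of paths with
    g(t_i)_j > a for finitely many (t_i, j, a). The integral of Y vanishes on
    those sets, which form a pi-system generating the sigma-algebra, hence on all
    measurable sets.

    Integration by parts at z_n is only used for large n, and there it can be
    read off from the convergence: if Y is not 0 then delta z_n is not 0 for n
    large, whereas [divergence] is 0 wherever integration by parts has no
    solution ([is_divergence_get]).

    A point of measure theory runs through the part on the Cameron-Martin space:
    the derivative of a linear combination of almost everywhere differentiable
    functions takes arbitrary values on a null set and may fail to be measurable.
    Inner products are therefore computed on representatives of the derivatives
    ([L2_derivative], [cm_innerE]). *)


(** * Smooth functions of polynomial growth *)

Section smooth_algebra.
Variables (R : realType) (k d : nat).
Local Notation mx := 'M[R]_(k, d).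
Implicit Types (f g : mx -> R) (G : set (mx -> R)).

(** The part of [smooth_poly_growth] that concerns f alone and not its
    derivatives. *)
Record C1_poly_growth f : Prop := {
  C1_derivable : forall x i j, derivable f x (delta_mx i j) ;
  C1_continuous : continuous f ;
  C1_growth : poly_growth f }.

Lemma poly_growth_ge0 f : poly_growth f ->
  exists (C : R) (N : nat), 0 <= C /\ forall x, `|f x| <= C * (1 + `|x|) ^+ N.
Proof.
move=> [C [N fC]]; exists `|C|, N; split => // x.
by apply: (le_trans (fC x)); rewrite ler_wpM2r ?exprn_ge0 ?addr_ge0 ?ler_norm.
Qed.

Lemma C1_poly_growth_cst (c : R) : C1_poly_growth (fun=> c).
Proof.
split => [x i j||]; [exact: derivable_cst|exact: cst_continuous|].
by exists `|c|, 0%N => x; rewrite expr0 mulr1.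
Qed.

Lemma C1_poly_growthD f g :
  C1_poly_growth f -> C1_poly_growth g -> C1_poly_growth (f \+ g).
Proof.
move=> [df cf /poly_growth_ge0[C [N [C0 fC]]]].
move=> [dg cg /poly_growth_ge0[D [M [D0 gD]]]].
split=> [x i j|x|]; [exact: derivableD|exact: continuousD (cf x) (cg x)|].
exists (C + D), (N + M)%N => x /=.
apply: (le_trans (ler_normD _ _)); rewrite mulrDl lerD//.
- apply: (le_trans (fC x)); rewrite ler_wpM2l// ler_weXn2l ?leq_addr//.
  by rewrite lerDl.
- apply: (le_trans (gD x)); rewrite ler_wpM2l// ler_weXn2l ?leq_addl//.
  by rewrite lerDl.
Qed.

Lemma C1_poly_growthM f g :
  C1_poly_growth f -> C1_poly_growth g -> C1_poly_growth (f \* g).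
Proof.
move=> [df cf /poly_growth_ge0[C [N [C0 fC]]]].
move=> [dg cg /poly_growth_ge0[D [M [D0 gD]]]].
split=> [x i j|x|]; [exact: derivableM|exact: continuousM (cf x) (cg x)|].
exists (C * D), (N + M)%N => x /=.
by rewrite normrM exprD mulrACA ler_pM.
Qed.

Inductive generated_algebra G : (mx -> R) -> Prop :=
| ga_gen f : G f -> generated_algebra G f
| ga_cst c : generated_algebra G (fun=> c)
| ga_add f g : generated_algebra G f -> generated_algebra G g ->
    generated_algebra G (f \+ g)
| ga_mul f g : generated_algebra G f -> generated_algebra G g ->
    generated_algebra G (f \* g).

Lemma partialD f g p : C1_poly_growth f -> C1_poly_growth g ->
  partial (f \+ g) p = partial f p \+ partial g p.
Proof.
by move=> [df _ _] [dg _ _]; apply/funext => x; rewrite /partial/= deriveD.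
Qed.

Lemma partialM f g p : C1_poly_growth f -> C1_poly_growth g ->
  partial (f \* g) p = f \* partial g p \+ g \* partial f p.
Proof.
by move=> [df _ _] [dg _ _]; apply/funext => x; rewrite /partial/= deriveM.
Qed.

(** By Leibniz' rule an algebra is stable under differentiation as soon as the
    derivatives of its generators belong to it; all iterated derivatives are
    then in the algebra, where continuity and growth are controlled. *)
Lemma generated_algebra_smooth G :
    (forall f, G f -> C1_poly_growth f) ->
    (forall f p, G f -> generated_algebra G (partial f p)) ->
  forall f, generated_algebra G f -> smooth_poly_growth f.
Proof.
move=> GC1 Gpartial.
have C1 f : generated_algebra G f -> C1_poly_growth f.
  elim=> [{}f /GC1//|c|{}f g _ cf _ cg|{}f g _ cf _ cg].
  - exact: C1_poly_growth_cst.
  - exact: C1_poly_growthD.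
  - exact: C1_poly_growthM.
have stable f p : generated_algebra G f -> generated_algebra G (partial f p).
  elim=> [{}f /Gpartial//|c|{}f g Gf Gf' Gg Gg'|{}f g Gf Gf' Gg Gg'].
  - rewrite (_ : partial _ _ = fun=> 0); first exact: ga_cst.
    by apply/funext => x; rewrite /partial derive_cst.
  - by rewrite partialD; [exact: ga_add|exact: C1..].
  - by rewrite partialM; [apply: ga_add; apply: ga_mul|exact: C1..].
move=> f Gf l; suff /C1[] : generated_algebra G (partials f l) by [].
by elim: l f Gf => //= p l IHl f Gf; exact/IHl/stable.
Qed.

Lemma smooth_C1 f : smooth_poly_growth f -> C1_poly_growth f.
Proof. by move=> /(_ [::])[? ? ?]; split. Qed.

Lemma smooth_partial f p : smooth_poly_growth f -> smooth_poly_growth (partial f p).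
Proof. by move=> sf l; exact: (sf (p :: l)). Qed.

Lemma smooth_generated f :
  generated_algebra (@smooth_poly_growth R d k) f -> smooth_poly_growth f.
Proof.
apply: generated_algebra_smooth => {}f; first exact: smooth_C1.
by move=> p sf; exact/ga_gen/smooth_partial.
Qed.

Lemma smoothM f g : smooth_poly_growth f -> smooth_poly_growth g ->
  smooth_poly_growth (f \* g).
Proof. by move=> sf sg; apply/smooth_generated/ga_mul; exact: ga_gen. Qed.

Lemma smooth_cst (c : R) : smooth_poly_growth ((fun=> c) : mx -> R).
Proof. exact/smooth_generated/ga_cst. Qed.

Lemma smooth_sum (I : Type) (r : seq I) (F : I -> mx -> R) :
  (forall i, smooth_poly_growth (F i)) ->
  smooth_poly_growth (fun x => \sum_(i <- r) F i x).
Proof.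
move=> sF; elim: r => [|i r IHr].
  by under eq_fun do rewrite big_nil; exact: smooth_cst.
under eq_fun do rewrite big_cons.
by apply/smooth_generated/ga_add; apply: ga_gen.
Qed.

Lemma smooth_prod (I : Type) (r : seq I) (F : I -> mx -> R) :
  (forall i, smooth_poly_growth (F i)) ->
  smooth_poly_growth (fun x => \prod_(i <- r) F i x).
Proof.
move=> sF; elim: r => [|i r IHr].
  by under eq_fun do rewrite big_nil; exact: smooth_cst.
under eq_fun do rewrite big_cons.
exact: smoothM.
Qed.

End smooth_algebra.

Section sigmoid.
Variable R : realType.

(** A bounded smooth approximation of the indicator of ]0, +oo[ whose derivative
    is a polynomial in itself. *)
Definition sigmoid (y : R) : R := (1 + expR (- y))^-1.

Let den_gt0 y : 0 < 1 + expR (- y) :> R.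
Proof. by rewrite addr_gt0// expR_gt0. Qed.

Lemma sigmoid_ge0 y : 0 <= sigmoid y.
Proof. by rewrite invr_ge0 ltW. Qed.

Lemma sigmoid_le1 y : sigmoid y <= 1.
Proof. by rewrite invf_le1// lerDl expR_ge0. Qed.

Lemma is_derive_sigmoid (y : R) :
  is_derive y 1 sigmoid (sigmoid y * (1 - sigmoid y)).
Proof.
have e0 : 1 + expR y != 0 :> R by rewrite gt_eqF// addr_gt0// expR_gt0.
have e1 : expR y != 0 by rewrite expR_eq0.
have -> : sigmoid = cst 1 - (fun z => (1 + expR z)^-1).
  apply/funext => z; rewrite /sigmoid !fctE expRN.
  have ez : expR z != 0 by rewrite expR_eq0.
  have ez1 : 1 + expR z != 0 :> R by rewrite gt_eqF// addr_gt0// expR_gt0.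
  field.
  by rewrite ?ez ?ez1.
have d1 : derivable (cst 1 + expR : R -> R) y 1 by exact: derivableD.
have d2 : derivable (fun z => (1 + expR z)^-1) y 1 by exact: derivableV.
split; first exact: derivableB.
rewrite deriveB// derive_cst (deriveV (f := cst 1 + expR))//.
rewrite deriveD// derive_cst derive_val !fctE /cst /GRing.scale/=.
by field.
Qed.

(** The shift by n makes the limit 0, and not 1/2, at y = a: the argument
    n^2 (y - a) - n is at most -n for y <= a, and tends to +oo for y > a. *)
Lemma sigmoid_cvg_indic (a y : R) :
  sigmoid (n%:R ^+ 2 * (y - a) - n%:R) @[n --> \oo] --> ((a < y)%R%:R : R).
Proof.
have small n t : t <= - n%:R -> sigmoid t <= harmonic n.
  move=> tn; rewrite /sigmoid /harmonic lef_pV2 ?posrE//.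
  rewrite -natr1 addrC lerD2l (le_trans _ (expR_ge1Dx _))//.
  by rewrite -[leLHS]add0r lerD// lerNr.
have [ay|ya] := ltP a y; last first.
  apply: (@squeeze_cvgr _ _ _ _ (fun=> 0) (@harmonic R)) => //;
    [|exact: cvg_cst|exact: cvg_harmonic].
  apply: nearW => n; rewrite sigmoid_ge0 small//.
  rewrite gerDr ?mulr_ge0_le0 ?subr_le0 ?exprn_ge0//.
have sigmoidN t : 1 - sigmoid t = sigmoid (- t).
  rewrite /sigmoid opprK expRN.
  have et : expR t != 0 by rewrite expR_eq0.
  have et1 : 1 + expR t != 0 :> R by rewrite gt_eqF// addr_gt0// expR_gt0.
  by field; rewrite ?et ?et1.
apply: (@squeeze_cvgr _ _ _ _ (fun n => 1 - harmonic n) (fun=> 1)) => //;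
  [|by rewrite -[X in _ --> X]subr0; apply: cvgB; [exact: cvg_cst|exact: cvg_harmonic]
   |exact: cvg_cst].
near=> n; rewrite sigmoid_le1 andbT lerBlDr -lerBlDl sigmoidN small//.
rewrite lerN2.
(* from this rank on, n^2 (y - a) - n is at least n *)
have n1 : 2 / (y - a) <= n%:R by near: n; exact: nbhs_infty_ger.
rewrite ler_pdivrMr ?subr_gt0// in n1.
have n0 : 0 <= n%:R :> R by [].
by have := ler_wpM2l n0 n1; rewrite mulrA -expr2; lra.
Unshelve. all: by end_near. Qed.

End sigmoid.

(** * Logistic functions of an entry, and Borel functions of a matrix *)

Section sigmoid_coord.
Variables (R : realType) (k d : nat).
Local Notation mx := 'M[R]_(k, d).

(* A function of one entry has the difference quotients of a function of one
   real variable. *)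
Let coord_quotient (s : R -> R) (i : 'I_k) (j : 'I_d) (x v : mx) :
  (fun h : R => h^-1 *: (((fun y : mx => s (y i j)) \o shift x) (h *: v) - s (x i j))) =
  (fun h : R => h^-1 *: ((s \o shift (x i j)) (h *: v i j) - s (x i j))).
Proof. by apply/funext => h; rewrite /shift/= !mxE. Qed.

Lemma derivable_coord (s : R -> R) (i : 'I_k) (j : 'I_d) (x v : mx) :
  derivable s (x i j) (v i j) -> derivable (fun y : mx => s (y i j)) x v.
Proof. by rewrite /derivable coord_quotient. Qed.

Lemma derive_coord (s : R -> R) (i : 'I_k) (j : 'I_d) (x v : mx) :
  'D_v (fun y : mx => s (y i j)) x = 'D_(v i j) s (x i j).
Proof. by rewrite /derive coord_quotient. Qed.

Variables (a b : R).
Let s (t : R) := sigmoid (a * t + b).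

Let is_derive_s (t : R) : is_derive t 1 s (a * (s t * (1 - s t))).
Proof.
have da : is_derive t 1 (fun u : R => a * u + b) a.
  have -> : (fun u : R => a * u + b) = a *: id + cst b by [].
  by apply: is_derive_eq; rewrite addr0 /GRing.scale/= mulr1.
have [ds es] := is_derive_sigmoid (a * t + b).
have [dl el] := da.
split.
  apply/derivable1_diffP.
  by apply: differentiable_comp; apply/derivable1_diffP.
rewrite -derive1E (derive1_comp (g := @sigmoid R))// !derive1E es el.
by rewrite mulrC.
Qed.

(** As s' = a s (1 - s), the algebra generated by the single function s of an
    entry is stable under differentiation. *)
Lemma smooth_sigmoid_coord (i : 'I_k) (j : 'I_d) :
  smooth_poly_growth (fun x : mx => sigmoid (a * x i j + b)).
Proof.
pose f (x : mx) := s (x i j).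
apply: (@generated_algebra_smooth _ _ _ [set f]); last exact: ga_gen.
- move=> _ ->; split.
  + move=> x i' j'; apply: derivable_coord; rewrite mxE.
    case: (_ && _) => /=; last exact: derivable0.
    by have [] := is_derive_s (x i j).
  + move=> x; apply: (continuous_comp (f := fun y : mx => y i j)).
      exact: coord_continuous.
    apply: differentiable_continuous; apply/derivable1_diffP.
    by have [] := is_derive_s (x i j).
  + exists 1, 0%N => x; rewrite expr0 mulr1 ger0_norm ?sigmoid_ge0//.
    exact: sigmoid_le1.
- move=> _ p ->.
  have -> : partial f p =
      (fun=> a * (delta_mx p.1 p.2 : mx) i j) \* (f \* ((fun=> 1) \+ ((fun=> -1) \* f))).
    apply/funext => x; rewrite /partial derive_coord /= mxE mulN1r.
    case: (_ && _) => /=; last by rewrite derive0 mulr0 mul0r.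
    have [_ ->] := is_derive_s (x i j); by rewrite mulr1.
  have gf : generated_algebra [set f] f by exact: ga_gen.
  apply: ga_mul; first exact: ga_cst.
  apply: ga_mul => //; apply: ga_add; first exact: ga_cst.
  by apply: ga_mul => //; exact: ga_cst.
Qed.

End sigmoid_coord.

Section measurability.
Context (R : realType) (disp : measure_display) (T : measurableType disp).
Context (k d : nat) (ev : T -> 'M[R]_(k, d)).
Hypothesis mev : forall i j, measurable_fun [set: T] (fun t => ev t i j : R).

(** An open set of matrices is the countable union of the open boxes with
    rational vertices that it contains. *)
Lemma measurable_preimage_open (U : set 'M[R]_(k, d)) :
  open U -> measurable (ev @^-1` U).
Proof.
move=> oU.
pose box (p : 'M[rat * rat]_(k, d)) : set 'M[R]_(k, d) :=
  [set x | forall i j, x i j \in `](ratr (p i j).1), (ratr (p i j).2)[ ].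
pose F p := if `[< box p `<=` U >] then ev @^-1` (box p) else set0.
have -> : ev @^-1` U = \bigcup_p F p.
  apply/seteqP; split => t; last first.
    by move=> [p _]; rewrite /F; case: asboolP => // pU /pU.
  move=> /= Ut.
  have [P Pt PU] : nbhs (ev t) U by rewrite nbhsE; exists U.
  have sep i j : exists q : rat * rat,
      (ev t i j \in `](ratr q.1), (ratr q.2)[) /\
      forall y, y \in `](ratr q.1), (ratr q.2)[ -> P i j y.
    have /nbhs_ballP[e /= e0 eP] := Pt i j.
    have [q1] := @rat_in_itvoo R (ev t i j - e) (ev t i j) ltac:(by rewrite ltrBlDr ltrDl).
    have [q2] := @rat_in_itvoo R (ev t i j) (ev t i j + e) ltac:(by rewrite ltrDl).
    rewrite !in_itv/= => /andP[q2l q2u] /andP[q1l q1u].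
    exists (q1, q2); rewrite in_itv/= q1u q2l; split => // y.
    rewrite in_itv/= => /andP[q1y yq2]; apply: eP.
    by rewrite /ball/= ltr_distlC (lt_trans q1l)//= (lt_trans yq2).
  pose q i j := projT1 (cid (sep i j)).
  exists (\matrix_(i, j) q i j) => //; rewrite /F asboolT.
    by move=> i j; rewrite mxE /q; case: cid => /= r [].
  move=> x xq; apply: PU => i j; have := xq i j; rewrite mxE /q.
  by case: cid => /= r [_ rP] xr; exact: rP.
apply: countable_bigcupT_measurable => // p.
rewrite /F; case: asboolP => // _.
have -> : ev @^-1` box p = \bigcap_(ij in [set: 'I_k * 'I_d])
    ((fun t => ev t ij.1 ij.2) @^-1` `]ratr (p ij.1 ij.2).1, ratr (p ij.1 ij.2).2[%classic).
  apply/seteqP; split => t /= h; first by move=> [i j] _; exact: h.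
  by move=> i j; exact: (h (i, j)).
apply: fin_bigcap_measurable => // -[i j] _.
by rewrite -[X in measurable X]setTI; apply: mev.
Qed.

Lemma measurable_comp_continuous (f : 'M[R]_(k, d) -> R) :
  continuous f -> measurable_fun [set: T] (f \o ev).
Proof.
move=> /continuousP cf.
apply: (measurability (@RGenOInfty.G R) (RGenOInfty.measurableE R)) => _ [_ [x ->] <-].
rewrite setTI comp_preimage; apply: measurable_preimage_open; apply: cf.
exact: interval_open.
Qed.

End measurability.

(** * Cylindrical functions *)

Section cylindrical_functions.
Variables (R : realType) (d : nat).
Local Notation path := (pathspace R d).

Lemma measurable_path_coord (t : I01 R) (j : 'I_d) :
  measurable_fun [set: path] (fun g : path => g t 0 j : R).
Proof.
move=> _ B mB; rewrite setTI; apply: sub_sigma_algebra.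
by exists t, j, B.
Qed.

Lemma measurable_cyl_eval (F : cylinder R d)
    (f : 'M[R]_((cyl_k F).+1, d) -> R) :
  continuous f -> measurable_fun [set: path] (f \o cyl_eval F).
Proof.
apply: measurable_comp_continuous => i j.
under eq_fun do rewrite mxE.
exact: measurable_path_coord.
Qed.

Lemma measurable_cyl_fun (F : cylinder R d) :
  measurable_fun [set: path] (cyl_fun F).
Proof. by apply: measurable_cyl_eval; have [_ + _] := @cyl_smooth _ _ F [::]. Qed.

Lemma measurable_cyl_partial (F : cylinder R d) p :
  measurable_fun [set: path] (fun g => partial (@cyl_base _ _ F) p (cyl_eval F g)).
Proof. by apply: measurable_cyl_eval; have [_ + _] := @cyl_smooth _ _ F [:: p]. Qed.

(** The instants of F may be kept while its base function is changed. *)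
Lemma Zcyl_eval (F : cylinder R d) (f : 'M[R]_((cyl_k F).+1, d) -> R) :
  smooth_poly_growth f -> Zcyl (fun g : path => f (cyl_eval F g)).
Proof.
move=> sf.
by exists (Cylinder (cyl_time_gt0 F) (@cyl_time_lt _ _ F) (cyl_time1 F) sf).
Qed.

Lemma Zcyl_sqr (F : cylinder R d) : Zcyl (fun g => cyl_fun F g ^+ 2).
Proof.
under eq_fun do rewrite expr2.
by apply: (@Zcyl_eval F (fun x => @cyl_base _ _ F x * @cyl_base _ _ F x));
  apply: smoothM; exact: cyl_smooth.
Qed.

(** A cylinder needs increasing instants ending at 1; adding 1 to finitely many
    positive instants and sorting them gives such a sequence. *)
Lemma cylinder_instants (rs : seq R) :
  exists (K : nat) (tm : 'I_K.+1 -> I01 R),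
    [/\ 0 < val (tm ord0),
        forall i j : 'I_K.+1, (i < j)%N -> val (tm i) < val (tm j),
        val (tm ord_max) = 1 &
        forall r, r \in rs -> 0 < r <= 1 -> exists i, val (tm i) = r].
Proof.
pose s := sort <=%O (undup (1 :: [seq r <- rs | 0 < r <= 1])).
have ms r : (r \in s) = (r == 1) || (r \in rs) && (0 < r <= 1).
  by rewrite mem_sort mem_undup inE mem_filter andbC.
have s01 r : r \in s -> 0 < r <= 1.
  by rewrite ms => /predU1P[->|/andP[]//]; rewrite ltr01 lexx.
have slt : sorted <%O s by rewrite sort_lt_sorted undup_uniq.
have s1 : 1 \in s by rewrite ms eqxx.
have [K sK] : exists K, size s = K.+1.
  by case: (s) s1 => // x s' _; exists (size s').
have nths (i : 'I_K.+1) : nth 1 s i \in s by rewrite mem_nth// sK.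
have I01s (i : 'I_K.+1) : nth 1 s i \in `[0 : R, 1]%classic.
  by rewrite inE/= in_itv/=; have /andP[/ltW -> ->] := s01 _ (nths i).
exists K, (fun i : 'I_K.+1 => exist _ (nth 1 s i) (I01s i)); split => /=.
- by have /andP[] := s01 _ (nths ord0).
- by move=> i j ij; rewrite lt_sorted_ltn_nth ?inE ?sK.
- apply/eqP; rewrite eq_le; have /andP[_ ->] := s01 _ (nths ord_max).
  have {1}<- := nth_index 1 s1; rewrite lt_sorted_leq_nth ?inE ?sK//.
  + by rewrite -ltnS -sK index_mem.
  + by rewrite -sK index_mem.
- move=> r rrs r01; have rs' : r \in s by rewrite ms rrs r01 orbT.
  have ri : (index r s < K.+1)%N by rewrite -sK index_mem.
  by exists (Ordinal ri); rewrite /= nth_index.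
Qed.

(** These products are the test functions by which cylindrical functions
    determine a measure; the instants in l are arbitrary, possibly repeated. *)
Lemma Zcyl_prod_sigmoid (l : seq (I01 R * 'I_d * (R * R))) :
  Zcyl (fun g : path =>
    \prod_(p <- l) sigmoid (p.2.1 * g p.1.1 0 p.1.2 + p.2.2)).
Proof.
have [K [tm [tm0 tmlt tm1 tml]]] := cylinder_instants [seq val p.1.1 | p <- l].
pose idx (t : I01 R) := odflt ord0 [pick i | val (tm i) == val t].
(* all paths start at 0, so instant 0 contributes a constant factor *)
pose base (x : 'M[R]_(K.+1, d)) := \prod_(p <- l)
  sigmoid ((if 0 < val p.1.1 then p.2.1 else 0) * x (idx p.1.1) p.1.2 + p.2.2).
have sbase : smooth_poly_growth base.
  by apply: smooth_prod => p; exact: smooth_sigmoid_coord.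
exists (Cylinder tm0 tmlt tm1 sbase) => //.
apply/funext => g; rewrite /cyl_fun/= /base; set x := cyl_eval _ g.
suff : forall l', {subset [seq val p.1.1 | p <- l'] <= [seq val p.1.1 | p <- l]} ->
    \prod_(p <- l')
      sigmoid ((if 0 < val p.1.1 then p.2.1 else 0) * x (idx p.1.1) p.1.2 + p.2.2) =
    \prod_(p <- l') sigmoid (p.2.1 * g p.1.1 0 p.1.2 + p.2.2) by exact.
elim=> [|p l' IHl] sub; first by rewrite !big_nil.
rewrite !big_cons IHl; last by move=> r rl'; apply: sub; rewrite inE rl' orbT.
suff -> : (if 0 < val p.1.1 then p.2.1 else 0) * x (idx p.1.1) p.1.2 =
  p.2.1 * g p.1.1 0 p.1.2 by [].
rewrite mxE; have := valP p.1.1; rewrite inE/= in_itv/= => /andP[p0 p1].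
case: ltP => [pgt0|ple0].
  have [|i ip] := tml _ (sub _ (mem_head _ _)); first by rewrite pgt0 p1.
  rewrite /idx; case: pickP => [i' /eqP/val_inj ->//|/(_ i)].
  by rewrite ip eqxx.
have -> : p.1.1 = I01_0 by apply: val_inj; apply/eqP; rewrite eq_le ple0 p0.
by rewrite path_at0 mxE mulr0 mul0r.
Qed.

Lemma Zcyl1 : Zcyl (fun _ : path => 1 : R).
Proof.
have := Zcyl_prod_sigmoid [::].
by under [X in Zcyl X]eq_fun do rewrite big_nil.
Qed.

End cylindrical_functions.

(** * The Cameron-Martin inner product *)

Section integral_ae.
Local Open Scope ereal_scope.
Context disp (T : measurableType disp) (R : realType).
Variable mu : {measure set T -> \bar R}.
Import HBNNSimple.
Implicit Types f g : T -> \bar R.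

Let ge0_le f g : (forall x, 0 <= f x) -> (forall x, 0 <= g x) ->
  {ae mu, forall x, f x = g x} -> \int[mu]_x f x <= \int[mu]_x g x.
Proof.
move=> f0 g0 [N [mN N0 fgN]].
rewrite (ge0_integralTE _ f0) (ge0_integralTE _ g0).
apply: ge_ereal_sup => _ [h hf <-].
(* h cut off on the null set lies below g *)
pose h' := proj_nnsfun h (measurableC mN).
have h'E x : h' x = (h x * \1_(~` N) x)%R by [].
have -> : sintegral mu h = sintegral mu h'.
  rewrite -!integralT_nnsfun; apply: ge0_ae_eq_integral => //.
  - by apply/measurable_EFinP.
  - by apply/measurable_EFinP.
  - by move=> x _; rewrite lee_fin.
  - by move=> x _; rewrite lee_fin.
  exists N; split => // x /= /not_implyP[_ hh']; apply: contrapT => Nx.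
  by apply: hh'; rewrite mindicE mem_set// mulr1.
apply: ereal_sup_ubound; exists h' => // x; rewrite h'E indicE.
case: (boolP (x \in ~` N)) => [xN|]; last by rewrite mulr0.
rewrite mulr1 (le_trans (hf x))//.
suff -> : f x = g x by [].
apply: contrapT => fg; move: xN; rewrite inE; apply.
by apply: fgN.
Qed.

(** The integral of a non-measurable function is still the supremum of the
    integrals of the simple functions below it, and cutting those off on a null
    set does not change their integrals. *)
Lemma ae_eq_integral_nonmeasurable (D : set T) f g :
  {ae mu, forall x, D x -> f x = g x} ->
  \int[mu]_(x in D) f x = \int[mu]_(x in D) g x.
Proof.
move=> fg; rewrite integral_mkcond [RHS]integral_mkcond.
have {}fg : {ae mu, forall x, (f \_ D) x = (g \_ D) x}.
  apply: filterS fg => x; rewrite !patchE => fg.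
  by case: ifPn => // /set_mem.
move: (f \_ D) (g \_ D) fg => {}f {}g fg.
rewrite integralE [RHS]integralE; congr (_ - _).
- apply/eqP; rewrite eq_le !ge0_le//.
  + by apply: filterS fg => x; rewrite !funeposE => ->.
  + by apply: filterS fg => x; rewrite !funeposE => ->.
- apply/eqP; rewrite eq_le !ge0_le//.
  + by apply: filterS fg => x; rewrite !funenegE => ->.
  + by apply: filterS fg => x; rewrite !funenegE => ->.
Qed.

End integral_ae.

Section L2_derivative.
Variables (R : realType) (d : nat).
Local Notation mu := (@lebesgue_measure R).
Local Notation I := (`[0%R, 1%R]%classic : set R).
Implicit Types (h : R -> 'rV[R]_d) (u v w : R -> 'rV[R]_d).

Record square_integrable v : Prop := {
  sq_measurable : forall j, measurable_fun I (fun x => v x 0 j : R) ;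
  sq_finite : (\int[mu]_(x in I) (dotv (v x) (v x))%:E < +oo)%E }.

(** [derive1] takes arbitrary values on the null set where a linear combination
    of functions is not differentiable, hence a derivative is replaced here with
    a function v to which it is almost everywhere equal. *)
Record L2_derivative h v : Prop := {
  L2d_ae : {ae mu, forall x, I x -> is_derive x 1 h (v x)} ;
  L2d_sq : square_integrable v }.

Definition L2_inner u v : R := (\int[mu]_(x in I) dotv (u x) (v x))%R.

Lemma dotvC (a b : 'rV[R]_d) : dotv a b = dotv b a.
Proof. by apply: eq_bigr => j _; rewrite mulrC. Qed.

Lemma dotvDl (a b c : 'rV[R]_d) : dotv (a + b) c = dotv a c + dotv b c.
Proof. by rewrite -big_split; apply: eq_bigr => j _; rewrite mxE mulrDl. Qed.

Lemma dotvZl k (a b : 'rV[R]_d) : dotv (k *: a) b = k * dotv a b.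
Proof. by rewrite big_distrr; apply: eq_bigr => j _ /=; rewrite mxE mulrA. Qed.

Lemma dotv_ge0 (a : 'rV[R]_d) : 0 <= dotv a a.
Proof. by apply: sumr_ge0 => j _; rewrite -expr2 sqr_ge0. Qed.

Lemma normr_dotv_le (a b : 'rV[R]_d) : `|dotv a b| <= dotv a a + dotv b b.
Proof.
rewrite -big_split; apply: (le_trans (ler_norm_sum _ _ _)); apply: ler_sum => j _.
rewrite ler_norml /=; apply/andP; split; nra.
Qed.

Let mI : measurable (I : set (g_sigma_algebraType R.-ocitv.-measurable)).
Proof. exact: measurable_itv. Qed.

Lemma measurable_dotv u v :
  (forall j, measurable_fun I (fun x => u x 0 j : R)) ->
  (forall j, measurable_fun I (fun x => v x 0 j : R)) ->
  measurable_fun I (fun x => dotv (u x) (v x)).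
Proof.
by move=> mu_ mv; apply: measurable_sum => j; exact: measurable_funM.
Qed.

Lemma integrable_dotvv v : square_integrable v ->
  mu.-integrable I (EFin \o (fun x => dotv (v x) (v x))).
Proof.
move=> [mv fv]; apply/integrableP; split.
  by apply/measurable_EFinP; exact: measurable_dotv.
under eq_integral do rewrite /= ger0_norm ?dotv_ge0//.
exact: fv.
Qed.

Lemma integrable_dotv u v : square_integrable u -> square_integrable v ->
  mu.-integrable I (EFin \o (fun x => dotv (u x) (v x))).
Proof.
move=> su sv.
have := integrableD mI (integrable_dotvv su) (integrable_dotvv sv).
apply: le_integrable.
- exact: mI.
- by apply/measurable_EFinP; apply: measurable_dotv; exact: sq_measurable.
- move=> x _; rewrite /= lee_fin [leRHS]ger0_norm ?addr_ge0 ?dotv_ge0//.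
  exact: normr_dotv_le.
Qed.

Lemma square_integrableZD k u v : square_integrable u -> square_integrable v ->
  square_integrable (fun x => k *: u x + v x).
Proof.
move=> su sv; have [mu_ _] := su; have [mv _] := sv.
have mw j : measurable_fun I (fun x => (k *: u x + v x) 0 j : R).
  under [X in measurable_fun _ X]eq_fun do rewrite !mxE.
  by apply: measurable_funD => //; apply: measurable_funM.
split => //.
pose c : R := 2 * (1 + k ^+ 2).
have iB : mu.-integrable I
    (fun x => (c * (dotv (u x) (u x) + dotv (v x) (v x)))%:E).
  exact: (integrableZl mI c
    (integrableD mI (integrable_dotvv su) (integrable_dotvv sv))).
suff /integrableP[_] : mu.-integrable I
    (EFin \o (fun x => dotv (k *: u x + v x) (k *: u x + v x))).
  by under eq_integral do rewrite /= ger0_norm ?dotv_ge0//.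
apply: le_integrable iB; first exact: mI.
  by apply/measurable_EFinP; exact: measurable_dotv.
move=> x _ /=; rewrite lee_fin ger0_norm ?dotv_ge0// ger0_norm; last first.
  by rewrite !mulr_ge0// ?addr_ge0// ?dotv_ge0 ?sqr_ge0.
rewrite /dotv -big_split big_distrr /=; apply: ler_sum => j _; rewrite !mxE /c.
move: (u x 0 j) (v x 0 j) => p q.
have h1 := sqr_ge0 (k * p - q); have h2 := sqr_ge0 p; have h3 := sqr_ge0 (k * q).
nra.
Qed.

Lemma L2_innerC u v : L2_inner u v = L2_inner v u.
Proof. by apply: eq_Rintegral => x _; rewrite dotvC. Qed.

Lemma L2_innerZDl k u v w : square_integrable u -> square_integrable v ->
    square_integrable w ->
  L2_inner (fun x => k *: u x + v x) w = k * L2_inner u w + L2_inner v w.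
Proof.
move=> su sv sw; rewrite /L2_inner.
under eq_Rintegral do rewrite dotvDl dotvZl.
have iu := integrable_dotv su sw.
rewrite RintegralD//; last exact: integrable_dotv.
  by rewrite RintegralZl.
exact: (integrableZl mI k iu).
Qed.

Lemma square_integrable0 : square_integrable (fun=> 0).
Proof.
split=> [j|]; first by under [X in measurable_fun _ X]eq_fun do rewrite mxE; exact: measurable_cst.
rewrite integral0_eq// => x _.
by rewrite /dotv big1// => j _; rewrite mxE mul0r.
Qed.

Lemma L2_inner0l w : L2_inner (fun=> 0) w = 0.
Proof.
rewrite /L2_inner /Rintegral integral0_eq// => x _.
by rewrite /dotv big1// => j _; rewrite mxE mul0r.
Qed.

Lemma L2_derivativeZD k f g u v : L2_derivative f u -> L2_derivative g v ->
  L2_derivative (fun x => k *: f x + g x) (fun x => k *: u x + v x).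
Proof.
move=> [df su] [dg sv]; split; last exact: square_integrableZD.
apply: (@filterS2 _ _ (ae_filter_ringOfSetsType mu)) df dg => x df dg Ix.
exact: is_deriveD (is_deriveZ _ (df Ix)) (dg Ix).
Qed.

Lemma L2_derivative0 : L2_derivative (fun=> 0) (fun=> 0).
Proof.
split; last exact: square_integrable0.
apply: (@nearW _ _ _ (ae_filter_ringOfSetsType mu)) => x _; exact: is_derive_cst.
Qed.

Lemma cm_innerE f g u v : L2_derivative f u -> L2_derivative g v ->
  cm_inner f g = L2_inner u v.
Proof.
move=> [df _] [dg _]; congr fine; apply: ae_eq_integral_nonmeasurable.
apply: (@filterS2 _ _ (ae_filter_ringOfSetsType mu)) df dg => x df dg Ix.
by rewrite !derive1E; have [_ ->] := df Ix; have [_ ->] := dg Ix.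
Qed.

Lemma cameron_martin_L2_derivative h : cameron_martin h ->
  L2_derivative h (derive1 h).
Proof.
move=> [_ _ dh mh fh]; split => //.
apply: (@filterS _ _ (ae_filter_ringOfSetsType mu)) dh => x dh Ix; rewrite derive1E; apply: derivableP.
by apply: dh; rewrite inE.
Qed.

Lemma L2_derivative_sum (J : Type) (k : J -> R) (f u : J -> R -> 'rV[R]_d)
    (r : seq J) :
  (forall i, L2_derivative (f i) (u i)) ->
  L2_derivative (fun x => \sum_(i <- r) k i *: f i x)
                (fun x => \sum_(i <- r) k i *: u i x).
Proof.
move=> fu; elim: r => [|i r IHr].
  under [X in L2_derivative X _]eq_fun do rewrite big_nil.
  under [X in L2_derivative _ X]eq_fun do rewrite big_nil.
  exact: L2_derivative0.
under [X in L2_derivative X _]eq_fun do rewrite big_cons.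
under [X in L2_derivative _ X]eq_fun do rewrite big_cons.
exact: L2_derivativeZD.
Qed.

Lemma square_integrable_sum (J : Type) (k : J -> R) (u : J -> R -> 'rV[R]_d)
    (r : seq J) : (forall i, square_integrable (u i)) ->
  square_integrable (fun x => \sum_(i <- r) k i *: u i x).
Proof.
move=> su; elim: r => [|i r IHr].
  by under eq_fun do rewrite big_nil; exact: square_integrable0.
under eq_fun do rewrite big_cons.
exact: square_integrableZD.
Qed.

Lemma L2_inner_suml (J : Type) (k : J -> R) (u : J -> R -> 'rV[R]_d)
    (r : seq J) w :
  (forall i, square_integrable (u i)) -> square_integrable w ->
  L2_inner (fun x => \sum_(i <- r) k i *: u i x) w =
  \sum_(i <- r) k i * L2_inner (u i) w.
Proof.
move=> su sw; elim: r => [|i r IHr].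
  rewrite big_nil; under eq_fun do rewrite big_nil.
  exact: L2_inner0l.
rewrite big_cons -IHr; under eq_fun do rewrite big_cons.
by rewrite L2_innerZDl//; exact: square_integrable_sum.
Qed.

Lemma L2_inner_ge0 v : 0 <= L2_inner v v.
Proof. by apply: Rintegral_ge0 => x _; exact: dotv_ge0. Qed.

(** The discriminant of the nonnegative quadratic t |-> |t u + v|^2. *)
Lemma L2_cauchy_schwarz u v : square_integrable u -> square_integrable v ->
  L2_inner u v ^+ 2 <= L2_inner u u * L2_inner v v.
Proof.
move=> su sv.
have poly t : 0 <= t ^+ 2 * L2_inner u u + 2 * t * L2_inner u v + L2_inner v v.
  pose w x := t *: u x + v x.
  have sw : square_integrable w by exact: square_integrableZD.
  have := L2_inner_ge0 w; rewrite {1}/w L2_innerZDl//.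
  rewrite (L2_innerC u w) (L2_innerC v w) !L2_innerZDl// (L2_innerC v u).
  by congr (0 <= _); ring.
move: poly; move: (L2_inner_ge0 u) (L2_inner_ge0 v).
move: (L2_inner u u) (L2_inner u v) (L2_inner v v) => a b c a0 c0 poly.
have [a_eq0|a_neq0] := eqVneq a 0.
  (* for a = 0 the polynomial is affine; it takes the value - c - 2 here *)
  have := poly (- (c + 1) / b).
  have [->|b0] := eqVneq b 0; first by rewrite expr0n mulr_ge0.
  rewrite a_eq0 mulr0 add0r (_ : 2 * _ * b = - 2 * (c + 1)); last by field.
  by lra.
have := poly (- b / a).
have -> : (- b / a) ^+ 2 * a + 2 * (- b / a) * b + c = (a * c - b ^+ 2) / a by field.
by rewrite pmulr_lge0 ?subr_ge0// invr_gt0 lt_neqAle eq_sym a_neq0.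
Qed.

End L2_derivative.

(** * The derivative of cylindrical functions *)

Section ramp.
Variables (R : realType) (d : nat) (t : R) (j : 'I_d).
Local Notation mu := (@lebesgue_measure R).
Local Notation I := (`[0%R, 1%R]%classic : set R).

(** The Cameron-Martin element that represents evaluation at t of the j-th
    coordinate; its derivative is the indicator of s < t. *)
Definition ramp (s : R) : 'rV[R]_d := Num.min t s *: delta_mx 0 j.
Definition dramp (s : R) : 'rV[R]_d := (s < t)%R%:R *: delta_mx 0 j.

Let is_derive_ramp (x : R) : x != t -> is_derive x 1 ramp (dramp x).
Proof.
rewrite neq_lt /dramp => /orP[xt|tx].
- rewrite xt scale1r.
  have dl : is_derive x 1 (fun s : R => s *: (delta_mx 0 j : 'rV[R]_d)) (delta_mx 0 j).
    split; first exact: diff_derivable.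
    by rewrite deriveE// diff_val scale1r.
  apply: near_eq_is_derive dl.
  near=> s; rewrite /ramp min_r//; apply: ltW; near: s; exact: lt_nbhsl.
- rewrite ltNge (ltW tx) scale0r.
  have dl : is_derive x 1 (fun s : R => t *: (delta_mx 0 j : 'rV[R]_d)) 0.
    exact: is_derive_cst.
  apply: near_eq_is_derive dl.
  near=> s; rewrite /ramp min_l//; apply: ltW; near: s; exact: lt_nbhsr.
Unshelve. all: by end_near. Qed.

Lemma L2_derivative_ramp : L2_derivative ramp dramp.
Proof.
split.
  exists [set t]; split; [exact: measurable_set1|exact: lebesgue_measure_set1|].
  move=> x /= /not_implyP[_ dx]; apply: contrapT => /eqP xt; apply: dx.
  exact: is_derive_ramp.
have mlt : measurable_fun I (fun x : R => (x < t)%R%:R : R).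
  have -> : (fun x : R => (x < t)%R%:R : R) = \1_(`]-oo, t[%classic).
    by apply/funext => x; rewrite indicE mem_setE in_itv.
  exact: measurable_indic.
split=> [j'|].
  under [X in measurable_fun _ X]eq_fun do rewrite !mxE.
  by apply: measurable_funM => //; exact: measurable_cst.
have dd x : dotv (dramp x) (dramp x) = (x < t)%R%:R.
  rewrite /dotv (bigD1 j)//= big1 ?addr0 => [|j' /negbTE jj'];
    rewrite !mxE ?eqxx ?jj' ?andbF ?mulr0 ?mul0r//=.
  by case: (x < t); rewrite ?mul0r ?mulr1.
under eq_integral do rewrite dd.
apply: (@le_lt_trans _ _ (\int[mu]_(x in I) (cst 1 x))%E).
  apply: ge0_le_integral => //.
  - exact/measurable_EFinP.
  - by move=> x _; rewrite lee_fin; case: (x < t).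
rewrite integral_cst//= mul1e lebesgue_measure_itv/= lte01 oppr0 adde0.
exact: ltry.
Qed.

End ramp.

Section malliavin_derivative.
Variables (R : realType) (d : nat).
Local Notation path := (pathspace R d).
Implicit Types (F : cylinder R d) (g : path).

Definition cyl_coef F g (p : 'I_(cyl_k F).+1 * 'I_d) : R :=
  partial (@cyl_base _ _ F) p (cyl_eval F g).

(** The derivative expanded on the finitely many directions attached to F, which
    do not depend on the path. *)
Lemma cyl_DE F g : cyl_D F g =
  fun s => \sum_(p : 'I_(cyl_k F).+1 * 'I_d)
    cyl_coef g p *: ramp (val (cyl_time p.1)) p.2 s.
Proof.
apply/funext => s; rewrite /cyl_D.
rewrite (eq_bigr (fun p : 'I_(cyl_k F).+1 * 'I_d =>
  cyl_coef g (p.1, p.2) *: ramp (val (cyl_time p.1)) p.2 s)); last by case.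
rewrite -(pair_big xpredT xpredT
  (fun i j => cyl_coef g (i, j) *: ramp (val (cyl_time i)) j s))/=.
apply: eq_bigr => i _.
rewrite [gradient _ _ _]row_sum_delta scaler_sumr; apply: eq_bigr => j _.
by rewrite mxE /ramp !scalerA mulrC.
Qed.

Definition cyl_dD F g (s : R) : 'rV[R]_d :=
  \sum_(p : 'I_(cyl_k F).+1 * 'I_d) cyl_coef g p *: dramp (val (cyl_time p.1)) p.2 s.

Lemma L2_derivative_cyl_D F g : L2_derivative (cyl_D F g) (cyl_dD F g).
Proof.
by rewrite cyl_DE; apply: L2_derivative_sum => p; exact: L2_derivative_ramp.
Qed.

(** The square norm of the derivative of a cylindrical function is a quadratic
    form in its partial derivatives, hence cylindrical. *)
Lemma Zcyl_sqr_norm_D F : Zcyl (fun g => cm_inner (cyl_D F g) (cyl_D F g)).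
Proof.
pose c (p q : 'I_(cyl_k F).+1 * 'I_d) : R :=
  L2_inner (dramp (val (cyl_time p.1)) p.2) (dramp (val (cyl_time q.1)) q.2).
have sq p : square_integrable (dramp (val (@cyl_time _ _ F p.1)) p.2 : R -> 'rV[R]_d).
  exact: L2d_sq (L2_derivative_ramp _ _).
pose f x := \sum_p partial (@cyl_base _ _ F) p x *
  \sum_q partial (@cyl_base _ _ F) q x * c q p.
have -> : (fun g => cm_inner (cyl_D F g) (cyl_D F g)) = f \o cyl_eval F.
  apply/funext => g; have D := L2_derivative_cyl_D F g.
  rewrite (cm_innerE D D) L2_inner_suml//; last exact: L2d_sq D.
  by apply: eq_bigr => p _; rewrite L2_innerC L2_inner_suml.
apply: Zcyl_eval; apply: smooth_sum => p.
apply: (@smoothM _ _ _ _ (fun x => \sum_q _ * c q p)).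
  exact/smooth_partial/cyl_smooth.
apply: smooth_sum => q.
apply: (@smoothM _ _ _ _ (fun=> c q p)); last exact: smooth_cst.
exact/smooth_partial/cyl_smooth.
Qed.

Section field.
Variable z : path -> R -> 'rV[R]_d.
Hypothesis Zz : Zcyl_H z.

(** For a fixed path, z is a combination of finitely many Cameron-Martin elements
    that do not depend on the path, hence inner products are polynomials in
    cylindrical functions and are measurable. *)
Lemma Zcyl_H_L2_derivative : exists dz : path -> R -> 'rV[R]_d,
  [/\ forall g, L2_derivative (z g) (dz g),
      forall w : R -> 'rV[R]_d, square_integrable w ->
        measurable_fun [set: path] (fun g => L2_inner (dz g) w) &
      measurable_fun [set: path] (fun g => L2_inner (dz g) (dz g))].
Proof.
have [m [F [h [ZF Hh ->]]]] := Zz.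
have dh j := cameron_martin_L2_derivative (Hh j).
have sh j := L2d_sq (dh j).
pose dz g s := \sum_(j < m) F j g *: derive1 (h j) s.
have Ldz g : L2_derivative (fun s => \sum_(j < m) F j g *: h j s) (dz g).
  exact: L2_derivative_sum.
have mF j : measurable_fun [set: path] (F j).
  by have [C _ <-] := ZF j; exact: measurable_cyl_fun.
have dzl w : square_integrable w -> (fun g => L2_inner (dz g) w) =
    (fun g => \sum_(j < m) F j g * L2_inner (derive1 (h j)) w).
  by move=> sw; apply/funext => g; rewrite L2_inner_suml.
have mdz w : square_integrable w ->
    measurable_fun [set: path] (fun g => L2_inner (dz g) w).
  move=> sw; rewrite dzl//; apply: measurable_sum => j.
  by apply: measurable_funM => //; exact: measurable_cst.
exists dz; split=> //.
rewrite (_ : (fun g => _) =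
    (fun g => \sum_(j < m) F j g * L2_inner (dz g) (derive1 (h j)))).
  apply: measurable_sum => j; apply: measurable_funM => //.
  by apply: mdz; exact: L2d_sq.
apply/funext => g; rewrite L2_inner_suml//; last exact: L2d_sq (Ldz g).
by apply: eq_bigr => j _; rewrite L2_innerC.
Qed.

End field.
End malliavin_derivative.

(** * Cauchy-Schwarz between a measure and a weighted measure *)

Section weighted_space.
Context disp (T : measurableType disp) (R : realType).
Variable (P : probability T R) (phi : T -> \bar R).
Hypotheses (mphi : measurable_fun [set: T] phi) (phi0 : forall x, (0 <= phi x)%E).
Hypothesis iphi : P.-integrable [set: T] phi.
Local Notation weighted := (density_measure P mphi phi0).
Local Open Scope ereal_scope.

Lemma null_density : weighted `<< P.
Proof.
apply/null_content_dominatesP => A mA A0.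
by apply: null_set_integral => //; exact: measurable_funTS.
Qed.

(** The density measure again; the proof of integrability is an argument so that
    its structure of finite measure can be inferred from it. *)
Definition finite_density of P.-integrable [set: T] phi : set T -> \bar R :=
  weighted.

HB.instance Definition _ i := Measure.copy (finite_density i) weighted.

Let finite_density_fin i : fin_num_fun (finite_density i).
Proof.
move=> A mA; apply: integrable_fin_num => //.
exact: (integrableS measurableT).
Qed.

HB.instance Definition _ i :=
  Measure_isFinite.Build _ _ _ (finite_density i) (finite_density_fin i).

(** The weight is almost everywhere the Radon-Nikodym derivative of the measure
    of which it is the density. *)
Lemma ge0_integral_density (f : T -> \bar R) :
  (forall x, 0 <= f x) -> measurable_fun [set: T] f ->
  \int[weighted]_x f x = \int[P]_x (f x * phi x).
Proof.
move=> f0 mf; pose fw := finite_density iphi.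
have dom : fw `<< P by exact: null_density.
rewrite -[LHS](Radon_Nikodym_SigmaFinite.change_of_variables dom f0 measurableT mf).
have mrn := measurable_int _ (Radon_Nikodym_SigmaFinite.f_integrable dom).
apply: ae_eq_integral => //; [by apply: emeasurable_funM..|].
apply: ae_eqe_mul2l; apply: integral_ae_eq => //.
  exact: Radon_Nikodym_SigmaFinite.f_integrable.
by move=> E _ mE; rewrite -Radon_Nikodym_SigmaFinite.f_integral.
Qed.

End weighted_space.

Section weighted_cauchy_schwarz.
Context disp (T : measurableType disp) (R : realType).
Variable (P : probability T R) (phi : T -> \bar R).
Hypotheses (mphi : measurable_fun [set: T] phi) (phi0 : forall x, (0 <= phi x)%E).
Hypothesis iphi : P.-integrable [set: T] phi.
Hypothesis ivphi : P.-integrable [set: T] (fun x => 1%:E / phi x)%E.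
Local Notation weighted := (density_measure P mphi phi0).
Local Notation p := (fine \o phi).

(** Integrability of phi makes it finite, that of 1 / phi makes it nonzero. *)
Lemma ae_weight_gt0 : {ae P, forall x, 0 < p x /\ phi x = (p x)%:E}.
Proof.
have h1 := integrable_ae measurableT iphi.
have h2 := integrable_ae measurableT ivphi.
apply: filterS2 h1 h2 => x /(_ I) f1 /(_ I) f2; split; last by rewrite /= fineK.
rewrite lt_neqAle fine_ge0// andbT; apply/eqP => /esym/= p0.
by move: f2; rewrite -(fineK f1) p0 inve0 mul1e.
Qed.

Lemma measurable_sqrt : measurable_fun [set: R] (@Num.sqrt R).
Proof. by apply: continuous_measurable_fun; exact: sqrt_continuous. Qed.

Lemma Lnorm2E (Q : {measure set T -> \bar R}) (u : T -> R) :
  (Lnorm Q 2%:E (EFin \o u) = (\int[Q]_x (u x ^+ 2)%:E) `^ 2^-1)%E.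
Proof.
rewrite unlock /Lnorm; congr (_ `^ _)%E; apply: eq_integral => x _ /=.
by rewrite powR_mulrn// real_normK ?num_real.
Qed.

Lemma Lfun2P (Q : {measure set T -> \bar R}) (u : T -> R) :
  u \in Lfun Q 2%:E ->
  measurable_fun [set: T] u /\ (Lnorm Q 2%:E (EFin \o u) < +oo)%E.
Proof. by move=> /andP[]; rewrite !inE. Qed.

(** Hoelder's inequality for the factors sqrt (a / phi) and U sqrt phi, whose
    product bounds X. *)
Lemma weighted_cauchy_schwarz (a X U : T -> R) :
  measurable_fun [set: T] a -> measurable_fun [set: T] X ->
  measurable_fun [set: T] U -> (forall x, 0 <= a x) ->
  P.-integrable [set: T] (fun x => (a x)%:E / phi x)%E ->
  (forall x, X x ^+ 2 <= a x * U x ^+ 2) ->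
  (\int[P]_x `|(X x)%:E| <= (\int[P]_x ((a x)%:E / phi x)) `^ 2^-1
     * Lnorm weighted 2%:E (EFin \o U))%E.
Proof.
move=> ma mX mU a0 ia XaU.
have mp : measurable_fun [set: T] p.
  exact: measurableT_comp.
have p0 x : 0 <= p x by rewrite fine_ge0.
(* a / phi is measurable by assumption; q is its real value *)
pose q x := fine ((a x)%:E / phi x)%E.
have q0 x : 0 <= q x by rewrite fine_ge0// mule_ge0 ?lee_fin// inve_ge0.
have qE : {ae P, forall x, [/\ 0 < p x, phi x = (p x)%:E & q x = a x / p x]}.
  apply: filterS ae_weight_gt0 => x [px phix]; split => //.
  by rewrite /q phix inver gt_eqF.
pose f x := Num.sqrt (q x).
pose g x := U x * Num.sqrt (p x).
have mf : measurable_fun [set: T] f.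
  apply: measurableT_comp measurable_sqrt _.
  exact: measurableT_comp (measurable_int _ ia).
have mg : measurable_fun [set: T] g.
  apply: measurable_funM => //; exact: measurableT_comp measurable_sqrt _.
apply: (@le_trans _ _ (Lnorm P 1 (EFin \o (f \* g)%R))).
  rewrite Lnorm1; apply: ae_ge0_le_integral => //.
  - by apply/measurableT_comp => //; exact/measurable_EFinP.
  - apply/measurableT_comp => //; apply/measurable_EFinP.
    exact: measurable_funM.
  apply: filterS qE => x [px _ qx] _ /=.
  rewrite lee_fin -(@ler_pXn2r _ 2) ?nnegrE// !real_normK ?num_real//.
  rewrite exprMn sqr_sqrtr// exprMn sqr_sqrtr// qx.
  rewrite (le_trans (XaU x))// le_eqVlt; apply/orP; left; apply/eqP; field.
  by rewrite gt_eqF.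
have h2 : 2^-1 + 2^-1 = 1 :> R by field.
apply: (le_trans (hoelder P mf mg (ltr0n R 2) (ltr0n R 2) h2)).
rewrite !Lnorm2E.
have -> : (\int[P]_x (f x ^+ 2)%:E = \int[P]_x ((a x)%:E / phi x))%E.
  apply: ae_eq_integral => //.
  + by apply/measurable_EFinP; exact: measurable_funX.
  + exact: measurable_int ia.
  apply: filterS qE => x [px -> qx] _.
  by rewrite sqr_sqrtr// inver gt_eqF// -EFinM qx.
have -> // : (\int[P]_x (g x ^+ 2)%:E = \int[weighted]_x (U x ^+ 2)%:E)%E.
rewrite ge0_integral_density//; last 2 first.
- by move=> x; rewrite lee_fin sqr_ge0.
- by apply/measurable_EFinP; exact: measurable_funX.
apply: ae_eq_integral => //.
- by apply/measurable_EFinP; exact: measurable_funX.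
- apply: emeasurable_funM => //; apply/measurable_EFinP; exact: measurable_funX.
apply: filterS qE => x [px -> _] _.
by rewrite exprMn sqr_sqrtr ?(ltW px)// EFinM.
Qed.

End weighted_cauchy_schwarz.

(** * Cylindrical functions determine integrable functions *)

Section cylinders_determine.
Variables (R : realType) (d : nat).
Local Notation path := (pathspace R d).
Local Notation cond := (I01 R * 'I_d * R)%type.
Implicit Types (l : seq cond) (g : path).

Definition above g (p : cond) : bool := p.2 < g p.1.1 0 p.1.2.

Definition upper_box l : set path := [set g | all (above g) l].

Definition upper_boxes : set (set path) := range upper_box.

(** Conditions at several instants are listed without any order, so that an
    intersection of boxes is a concatenation. *)
Lemma upper_boxes_setI : setI_closed upper_boxes.
Proof.
move=> _ _ [l _ <-] [l' _ <-]; exists (l ++ l') => //.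
by apply/seteqP; split => g /=; rewrite /upper_box /= all_cat => /andP.
Qed.

Lemma measurable_upper_box l : measurable (upper_box l).
Proof.
elim: l => [|p l IHl].
  by rewrite (_ : upper_box [::] = setT) //; apply/seteqP; split.
have -> : upper_box (p :: l) =
    (fun g : path => g p.1.1 0 p.1.2 : R) @^-1` `]p.2, +oo[ `&` upper_box l.
  by apply/seteqP; split => g; rewrite /upper_box /= in_itv /= andbT => /andP.
apply: measurableI => //; rewrite -[X in measurable X]setTI.
by apply: measurable_path_coord.
Qed.

Lemma measurable_path_upper_boxes : @measurable _ path = <<s upper_boxes >>.
Proof.
apply/seteqP; split.
  apply: smallest_sub; first exact: smallest_sigma_algebra.
  move=> _ [t [j [B [mB ->]]]].
  (* a coordinate map is measurable as soon as the preimages of rays are *)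
  have mev : measurable_fun [set: g_sigma_algebraType upper_boxes]
      (fun g : g_sigma_algebraType upper_boxes => (g : path) t 0 j : R).
    apply: (measurability (@RGenOInfty.G R) (RGenOInfty.measurableE R)).
    move=> _ [_ [x ->] <-]; rewrite setTI; apply: sub_sigma_algebra.
    exists [:: (t, j, x)] => //; apply/seteqP; split => g;
      by rewrite /upper_box /above /= in_itv/= !andbT.
  by have := mev measurableT B mB; rewrite setTI.
apply: smallest_sub; first exact: sigma_algebra_measurable.
by move=> _ [l _ <-]; exact: measurable_upper_box.
Qed.

Definition soft_box l (n : nat) g : R :=
  \prod_(p <- l) sigmoid (n%:R ^+ 2 * (g p.1.1 0 p.1.2 - p.2) - n%:R).

Lemma Zcyl_soft_box l n : Zcyl (soft_box l n).
Proof.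
have := Zcyl_prod_sigmoid
  [seq (p.1, (n%:R ^+ 2, - (n%:R ^+ 2 * p.2) - n%:R : R)) | p : cond <- l].
congr (Zcyl _); apply/funext => g; rewrite big_map; apply: eq_bigr => p _.
by rewrite /= mulrBr addrA.
Qed.

Lemma soft_box_ge0_le1 l n g : 0 <= soft_box l n g <= 1.
Proof.
apply/andP; split; first by apply: prodr_ge0 => p _; exact: sigmoid_ge0.
by apply: prodr_ile1 => p _; rewrite sigmoid_ge0 sigmoid_le1.
Qed.

Lemma soft_box_cvg l g : soft_box l n g @[n --> \oo] --> (\1_(upper_box l) g : R).
Proof.
rewrite indicE mem_setE /upper_box /soft_box.
elim: l => [|p l IHl] /=.
  by under eq_fun do rewrite big_nil; exact: cvg_cst.
under eq_fun do rewrite big_cons.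
rewrite -mulnb natrM; apply: cvgM IHl.
exact: sigmoid_cvg_indic.
Qed.

Variable nu : probability path R.

(** By dominated convergence along soft boxes, the integral of Y vanishes on
    every box; boxes form a pi-system that generates the sigma-algebra, so that
    it vanishes on every measurable set. *)
Lemma Zcyl_orthogonal_eq0 (Y : path -> R) :
  nu.-integrable [set: path] (EFin \o Y) ->
  (forall f, Zcyl f -> (\int[nu]_g (f g * Y g)%:E = 0)%E) ->
  {ae nu, forall g, Y g = 0}.
Proof.
move=> iY Yortho; have mY := measurable_int _ iY.
have box0 l : (\int[nu]_(g in upper_box l) (Y g)%:E = 0)%E.
  rewrite integral_mkcond.
  have mS n : measurable_fun [set: path] (soft_box l n).
    by have [F _ <-] := Zcyl_soft_box l n; exact: measurable_cyl_fun.
  have [|||||_ _] := @dominated_convergence _ _ _ nu _ measurableT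
    (fun n g => (soft_box l n g * Y g)%:E) ((EFin \o Y) \_ (upper_box l))
    (abse \o (EFin \o Y)).
  - move=> n; apply/measurable_EFinP; apply: measurable_funM => //.
    exact/measurable_EFinP.
  - apply/(measurable_restrictT _ (measurable_upper_box l)).
    exact: measurable_funTS.
  - apply: nearW => g _.
    rewrite epatch_indic /= -EFinM mulrC; apply: cvg_EFin; first exact: nearW.
    by apply: cvgM; [exact: soft_box_cvg|exact: cvg_cst].
  - exact: (integrable_abse iY).
  - apply: nearW => g n _; rewrite /= lee_fin normrM.
    have /andP[s0 s1] := soft_box_ge0_le1 l n g.
    by rewrite ger0_norm// ler_piMl.
  under eq_fun do rewrite (Yortho _ (Zcyl_soft_box l _)).
  by move=> /cvg_lim <- //; exact: lim_cst.
have all0 A : measurable A -> (\int[nu]_(g in A) (Y g)%:E = 0)%E.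
  rewrite measurable_path_upper_boxes; move: A.
  have full0 : (\int[nu]_(g in [set: path]) (Y g)%:E = 0)%E.
    by rewrite -(box0 [::]); congr integral; apply/seteqP; split.
  apply: dynkin_induction => //.
  - exact: measurable_path_upper_boxes.
  - exact: upper_boxes_setI.
  - by move=> _ [l _ <-].
  - move=> S mS S0.
    have := full0; rewrite -(setUv S) integral_setU//; last 3 first.
    + exact: measurableC.
    + by rewrite setUv.
    + by apply/disj_setPCl.
    by rewrite S0 add0e.
  - move=> F mF tF F0; rewrite integral_bigcup//.
      by rewrite eseries0// => i _ _; exact: F0.
    exact: (integrableS measurableT (bigcup_measurable (fun k _ => mF k))).
have Y0 : ae_eq nu setT (EFin \o Y) (cst 0%E).
  apply: (integral_ae_eq measurableT iY) => [|E _ mE]; first exact: measurable_cst.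
  by rewrite all0// integral0.
by apply: filterS Y0 => g /(_ Logic.I) [].
Qed.

End cylinders_determine.

(** * Closability *)

Section closability_of_divergence.
Variables (R : realType) (d : nat).
Local Notation path := (pathspace R d).
Variables (nu : probability path R) (phi : path -> \bar R).
Hypothesis mphi : measurable_fun [set: path] phi.
Hypothesis phi0 : forall g, (0 <= phi g)%E.
Hypothesis iphi : nu.-integrable [set: path] phi.
Hypothesis iZ : forall f, Zcyl f ->
  nu.-integrable [set: path] (fun g => (f g)%:E / phi g)%E.
Local Notation weighted := (density_measure nu mphi phi0).
Local Notation ratio_norm f := ((\int[nu]_g ((f g)%:E / phi g)) `^ 2^-1)%E.

Let iV : nu.-integrable [set: path] (fun g => 1%:E / phi g)%E.
Proof. exact: iZ (Zcyl1 R d). Qed.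

Lemma Zcyl_measurable f : Zcyl f -> measurable_fun [set: path] f.
Proof. by move=> [F _ <-]; exact: measurable_cyl_fun. Qed.

Lemma ratio_norm_fin f : Zcyl f -> ratio_norm f \is a fin_num.
Proof.
move=> Zf; rewrite fin_num_poweR//.
exact: integrable_fin_num (iZ Zf).
Qed.

(** The first factor on the right is finite because F^2 is cylindrical. *)
Lemma integral_ZcylM_le (F : cylinder R d) (U : path -> R) :
  measurable_fun [set: path] U ->
  (\int[nu]_g `|(cyl_fun F g * U g)%:E| <=
    ratio_norm (fun g => (cyl_fun F g ^+ 2)%R) * Lnorm weighted 2%:E (EFin \o U))%E.
Proof.
move=> mU; have ZF2 := Zcyl_sqr F.
apply: weighted_cauchy_schwarz => //.
- exact: Zcyl_measurable.
- by apply: measurable_funM => //; exact: measurable_cyl_fun.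
- by move=> g; exact: sqr_ge0.
- exact: iZ.
- by move=> g; rewrite exprMn.
Qed.

Lemma measurable_cm_inner_D (F : cylinder R d) (z : path -> R -> 'rV[R]_d) :
  Zcyl_H z ->
  measurable_fun [set: path] (fun g => cm_inner (cyl_D F g) (z g)).
Proof.
move=> Zz; have [dz [Lz mz _]] := Zcyl_H_L2_derivative Zz.
rewrite (_ : (fun g => _) = fun g => \sum_(p : 'I_(cyl_k F).+1 * 'I_d)
   cyl_coef g p * L2_inner (dz g) (dramp (val (cyl_time p.1)) p.2)).
  apply: measurable_sum => p; apply: measurable_funM.
    exact: measurable_cyl_partial.
  by apply: mz; exact: L2d_sq (L2_derivative_ramp _ _).
apply/funext => g; rewrite (cm_innerE (L2_derivative_cyl_D F g) (Lz g)).
rewrite L2_inner_suml.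
- by apply: eq_bigr => p _; rewrite L2_innerC.
- by move=> p; exact: L2d_sq (L2_derivative_ramp _ _).
- exact: L2d_sq (Lz g).
Qed.

(** The first factor on the right is finite because |DF|^2 is cylindrical. *)
Lemma integral_cm_inner_le (F : cylinder R d) (z : path -> R -> 'rV[R]_d) :
  Zcyl_H z ->
  (\int[nu]_g `|(cm_inner (cyl_D F g) (z g))%:E| <=
    ratio_norm (fun g => cm_inner (cyl_D F g) (cyl_D F g)) * L2H_norm weighted z)%E.
Proof.
move=> Zz; have ZD := Zcyl_sqr_norm_D F.
have [dz [Lz mz mzz]] := Zcyl_H_L2_derivative Zz.
have LD g := L2_derivative_cyl_D F g.
have zE g : cm_inner (z g) (z g) = L2_inner (dz g) (dz g).
  exact: cm_innerE (Lz g) (Lz g).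
apply: weighted_cauchy_schwarz => //.
- exact: Zcyl_measurable.
- exact: measurable_cm_inner_D.
- rewrite /cm_norm; apply: (measurableT_comp (@measurable_sqrt R)).
  by under eq_fun do rewrite zE.
- by move=> g; rewrite (cm_innerE (LD g) (LD g)) L2_inner_ge0.
- exact: iZ.
- move=> g; rewrite /cm_norm zE sqr_sqrtr ?L2_inner_ge0//.
  rewrite (cm_innerE (LD g) (Lz g)) (cm_innerE (LD g) (LD g)).
  by apply: L2_cauchy_schwarz; apply: L2d_sq.
Qed.

Lemma integrable_ZcylM (F : cylinder R d) (U : path -> R) :
  U \in Lfun weighted 2%:E ->
  nu.-integrable [set: path] (fun g => (cyl_fun F g * U g)%:E).
Proof.
move=> /Lfun2P[mU U2]; apply/integrableP; split.
  by apply/measurable_EFinP; apply: measurable_funM => //; exact: measurable_cyl_fun.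
apply: (le_lt_trans (integral_ZcylM_le F mU)).
rewrite lte_mul_pinfty ?poweR_ge0//.
by apply: ratio_norm_fin; exact: Zcyl_sqr.
Qed.

(** Integration by parts splits E[F Y] as E<DF, z_n> - E[F (X_n - Y)], and
    both terms are bounded by a constant times a norm that tends to 0. *)
Lemma divergence_limit_orthogonal (z : nat -> path -> R -> 'rV[R]_d)
    (X : nat -> path -> R) (Y : path -> R) :
  (forall n, Zcyl_H (z n)) ->
  (forall n, X n \in Lfun weighted 2%:E) ->
  Y \in Lfun weighted 2%:E ->
  L2H_norm weighted (z n) @[n --> \oo] --> 0%E ->
  Lnorm weighted 2%:E (fun g => (X n g - Y g)%:E) @[n --> \oo] --> 0%E ->
  (\forall n \near \oo, is_divergence nu (z n) (X n)) ->
  forall F : cylinder R d, (\int[nu]_g (cyl_fun F g * Y g)%:E = 0)%E.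
Proof.
move=> Zz LX LY z0 XY0 divX F.
have ZD := Zcyl_sqr_norm_D F; have ZF := Zcyl_sqr F.
set a := ratio_norm (fun g => cm_inner (cyl_D F g) (cyl_D F g)).
set b := ratio_norm (fun g => cyl_fun F g ^+ 2).
have afin : a \is a fin_num by exact: ratio_norm_fin ZD.
have bfin : b \is a fin_num by exact: ratio_norm_fin ZF.
have iFY := integrable_ZcylM F LY.
apply/eqP; rewrite -abse_eq0 eq_le abse_ge0 andbT.
pose err n := (a * L2H_norm weighted (z n) +
  b * Lnorm weighted 2%:E (fun g => (X n g - Y g)%:E))%E.
have err0 : err n @[n --> \oo] --> 0%E.
  rewrite -[X in _ --> X](_ : a * 0 + b * 0 = 0)%E; last by rewrite !mule0 adde0.
  apply: cvgeD; [by rewrite !mule0|exact: cvgeZl|exact: cvgeZl].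
apply: (cvge_ge _ err0).
apply: filterS divX => n [_ /(_ F) divn].
have iFX := integrable_ZcylM F (LX n).
have [mX _] := Lfun2P (LX n); have [mY _] := Lfun2P LY.
have -> : (\int[nu]_g (cyl_fun F g * Y g)%:E =
    \int[nu]_g (cm_inner (cyl_D F g) (z n g))%:E -
    \int[nu]_g (cyl_fun F g * (X n g - Y g))%:E)%E.
  rewrite -divn; under [X in (_ - X)%E]eq_integral do rewrite mulrBr EFinB.
  rewrite integralB// -(fineK (integrable_fin_num measurableT iFX)).
  rewrite -(fineK (integrable_fin_num measurableT iFY)).
  by rewrite -!EFinB subKr.
apply: (le_trans (lee_abs_sub _ _)); apply: leeD.
- apply: le_trans (integral_cm_inner_le F (Zz n)).
  apply: le_abse_integral => //; apply/measurable_EFinP.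
  exact: measurable_cm_inner_D.
- apply: le_trans (integral_ZcylM_le F _); last exact: measurable_funB.
  apply: le_abse_integral => //; apply/measurable_EFinP.
  by apply: measurable_funM; [exact: measurable_cyl_fun|exact: measurable_funB].
Qed.

(** The function chosen by [divergence] is 0 where integration by parts has no
    solution, hence it solves integration by parts wherever it is not 0. *)
Lemma is_divergence_get (z : path -> R -> 'rV[R]_d) :
  divergence nu z <> (fun=> 0) -> is_divergence nu z (divergence nu z).
Proof.
move=> nz; apply: contrapT => ndiv; apply: nz.
apply: getPN => Y divY; apply: ndiv; exact: getI divY.
Qed.

Lemma closable_divergence :
  closable weighted (@Zcyl_H R d) (divergence nu).
Proof.
move=> z Y Zz _ LX LY z0 XY0.
have [mY _] := Lfun2P LY.
have [Y0|Yn0] := eqVneq (Lnorm weighted 2%:E (EFin \o Y)) 0%E.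
  have := Lnorm_eq0_eq0 _ _ Y0; move=> /(_ _ _) H.
  have {}H : (EFin \o Y) = (cst 0%E) %[ae weighted].
    apply: H; [exact/measurable_EFinP|by rewrite lte_fin].
  by apply: filterS H => g /(_ Logic.I) [].
(* X_n = 0 would make |X_n - Y| equal to |Y|, which is not small *)
have divz : \forall n \near \oo, is_divergence nu (z n) (divergence nu (z n)).
  have YnormP : (0 < Lnorm weighted 2%:E (EFin \o Y))%E by rewrite lt0e Yn0 Lnorm_ge0.
  have : \forall n \near \oo, (Lnorm weighted 2%:E
      (fun g => (divergence nu (z n) g - Y g)%:E) < Lnorm weighted 2%:E (EFin \o Y))%E.
    exact: XY0 _ (open_ereal_lt' YnormP).
  apply: filterS => n nY; apply: is_divergence_get => X0; move: nY.
  rewrite X0 (_ : (fun g => _) = (\- (EFin \o Y))%E) ?oppe_Lnorm ?ltxx//.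
  by apply/funext => g; rewrite /= sub0r.
have Yortho := divergence_limit_orthogonal Zz LX LY z0 XY0 divz.
have iY : nu.-integrable [set: path] (EFin \o Y).
  have [F _ F1] := Zcyl1 R d.
  have := integrable_ZcylM F LY.
  by rewrite F1; under [X in integrable _ _ X]eq_fun do rewrite mul1r.
have [N [mN N0 YN]] : {ae nu, forall g, Y g = 0}.
  by apply: Zcyl_orthogonal_eq0 iY _ => _ [F _ <-]; exact: Yortho.
exists N; split => //.
by apply: null_set_integral => //; exact: measurable_funTS.
Qed.

End closability_of_divergence.

Theorem proposition3p7 (R : realType) (d : nat)
  (nu : probability (pathspace R d) R) (hnu : is_wiener nu)
  (phi : pathspace R d -> \bar R)
  (mphi : measurable_fun [set: pathspace R d] phi)
  (phi_ge0 : forall g, (0 <= phi g)%E)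
  (phi_int : nu.-integrable [set: pathspace R d] phi)
  (hZ : forall f, Zcyl f ->
     nu.-integrable [set: pathspace R d] (fun g => ((f g)%:E / phi g)%E)) :
  closable (density_measure nu mphi phi_ge0) (@Zcyl_H R d) (divergence nu).
Proof. exact: closable_divergence. Qed.
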